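(* There exists an absolute constant $c>0$ such that the following holds for every integer $n\ge 2$ and every $C\ge 2$. There exists a reference distribution $\mathbf{q}$ over $[n]$ such that any algorithm which, given $\mathbf{q}$, $C$, and i.i.d. samples from an unknown distribution $\mathbf{p}\in\Pi_n(\mathbf{q})$, distinguishes with probability at least $2/3$ between (i) $d_{\mathrm{TV}}(\mathbf{p},\mathbf{q})\le\frac{1}{4C-1}$ and (ii) $d_{\mathrm{TV}}(\mathbf{p},\mathbf{q})\ge\frac{C}{4C-1}$, must use at least $c\sqrt{\frac{n}{4^C}}$ samples.
   Context: $[n]=\{1,\dots,n\}$, $\mathcal{S}_n$ is the set of permutations of $[n]$, and a probability distribution over $[n]$ is identified with its probability mass function $[n]\to[0,1]$. For a distribution $\mathbf{q}$ over $[n]$, $\Pi_n(\mathbf{q})=\{\mathbf{q}\circ\pi : \pi\in\mathcal{S}_n\}$ is the set of distributions equal to $\mathbf{q}$ up to a permutation of the domain. The total variation distance is $d_{\mathrm{TV}}(\mathbf{p},\mathbf{q})=\sup_{S\subseteq[n]}(\mathbf{p}(S)-\mathbf{q}(S))=\frac12\sum_{i=1}^n|\mathbf{p}(i)-\mathbf{q}(i)|$. An algorithm using $s$ samples is a (possibly randomized) map from $[n]^s$ to $\{\mathsf{yes},\mathsf{no}\}$, applied to $s$ i.i.d. samples from $\mathbf{p}$; it may depend on $n$, $\mathbf{q}$ and the parameters but not on $\mathbf{p}$. It distinguishes between (i) and (ii) with probability at least $2/3$ if, for every $\mathbf{p}\in\Pi_n(\mathbf{q})$ satisfying (i), it outputs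 $\mathsf{yes}$ with probability at least $2/3$, and for every $\mathbf{p}\in\Pi_n(\mathbf{q})$ satisfying (ii), it outputs $\mathsf{no}$ with probability at least $2/3$ (probability over the samples and the internal randomness); no requirement is made for other $\mathbf{p}$. *)

(* Defs.v *)
From mathcomp Require Import all_boot all_order all_algebra all_fingroup.
From mathcomp Require Import all_classical all_reals all_analysis.
From mathcomp Require Import lra.

Set Implicit Arguments.
Unset Strict Implicit.
Unset Printing Implicit Defensive.

Import Order.TTheory GRing.Theory Num.Theory.
Local Open Scope classical_set_scope.
Local Open Scope ring_scope.

(* The domain [n] is 'I_n; the bound pmf i <= 1 follows from the two fields. *)
Record dist (R : realType) (n : nat) := Dist {
  pmf :> 'I_n -> R ;
  pmf_ge0 : forall i, 0 <= pmf i ;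
  pmf_sum1 : \sum_(i < n) pmf i = 1 }.

Definition mass (R : realType) (n : nat) (p : dist R n) (S : {set 'I_n}) : R :=
  \sum_(i in S) p i.

Definition dTV (R : realType) (n : nat) (p q : dist R n) : R :=
  sup (range (fun S : {set 'I_n} => mass p S - mass q S)).

Definition perm_class (R : realType) (n : nat) (q : dist R n) : set (dist R n) :=
  [set p : dist R n | exists pi : 'S_n, p =1 q \o pi].

(* The internal randomness is a seed drawn from an arbitrary probability space,
   independently of the samples; the output [true] stands for yes. *)
Record algorithm (R : realType) (n s : nat) := Algorithm {
  seed_display : measure_display ;
  seed : measurableType seed_display ;
  seed_prob : probability seed R ;
  decide : s.-tuple 'I_n -> seed -> bool ;
  measurable_decide : forall x, measurable_fun [set: seed] (decide x) }.

Arguments decide {R n s} a x w.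

(* Probability of the output [b] when the samples are i.i.d. from [p]. *)
Definition prob_output (R : realType) (n s : nat) (A : algorithm R n s)
    (p : dist R n) (b : bool) : R :=
  \sum_(x : s.-tuple 'I_n)
    (\prod_(j < s) p (tnth x j)) * fine (seed_prob A (decide A x @^-1` [set b])).

Definition distinguishes (R : realType) (n s : nat) (A : algorithm R n s)
    (q : dist R n) (near far : R) : Prop :=
  forall p : dist R n, perm_class q p ->
    (dTV p q <= near -> 2 / 3 <= prob_output A p true) /\
    (far <= dTV p q -> 2 / 3 <= prob_output A p false).

Lemma dTV_half_l1 (R : realType) (n : nat) (p q : dist R n) :
  dTV p q = (\sum_(i < n) `|p i - q i|) / 2.
Proof.
pose h := (\sum_(i < n) `|p i - q i|) / 2.
have d0 : \sum_(i < n) (p i - q i) = 0 by rewrite sumrB !pmf_sum1 subrr.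
have hE : h = \sum_(i < n) ((`|p i - q i| + (p i - q i)) / 2).
  by rewrite -mulr_suml big_split /= d0 addr0.
have massE S : mass p S - mass q S =
    \sum_(i < n) (if i \in S then p i - q i else 0).
  by rewrite /mass -sumrB big_mkcond.
have ubh S : mass p S - mass q S <= h.
  rewrite massE hE; apply: ler_sum => i _.
  have := ler_norm (p i - q i); have := ler_norm (- (p i - q i)).
  by rewrite normrN; case: ifP => _; lra.
apply/eqP; rewrite eq_le; apply/andP; split.
  by apply: ge_sup; [exists (mass p finset.set0 - mass q finset.set0), finset.set0
                    |move=> _ [S _ <-]; exact: ubh].
apply: ub_le_sup; first by exists h => _ [S _ <-]; exact: ubh.
exists (finset.finset (fun i => q i <= p i)) => //.
rewrite massE -/h hE; apply: eq_bigr => i _; rewrite inE.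
by case: (leP (q i) (p i)) => H; [rewrite ger0_norm|rewrite ltr0_norm]; lra.
Qed.

(* Main.v *)
Require Import Defs.
From mathcomp Require Import all_boot all_order all_algebra all_fingroup.
From mathcomp Require Import all_classical all_reals all_analysis.
From mathcomp Require Import ring lra.

Set Implicit Arguments.
Unset Strict Implicit.
Unset Printing Implicit Defensive.

Import Order.TTheory GRing.Theory Num.Theory.
Local Open Scope ring_scope.

(** The reference distribution consists of [m] identical small blocks (the
    gadget below, scaled by [1/m]) together with fixed points that absorb
    the remaining mass.  Every block can be rearranged by a permutation [near]
    or by a permutation [far].  If, in each block independently, the elements
    of equal weight are first shuffled uniformly, then a single sample of the
    block carries no information on which of [near] and [far] was applied: it
    only reveals a weight level, and both permutations give every level the
    same total mass.  So the two resulting random distributions can be told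
    apart only when two samples fall in the same block.  A block has mass at
    most [1/m], hence this has probability at most [s^2/m], and a tester needs
    of order [sqrt m] samples ([gadget_lower_bound]).

    The gadget turns one unit of mass displacement into many.  Its levels are
    [0, 1, 2, 4, ..., 2^l] (times a unit [u]).  The permutation [far] exchanges
    elements of adjacent levels, the number of exchanges between two levels
    being inversely proportional to their gap.  The same flux of mass then
    crosses each of the [l + 1] gaps, and the intermediate levels keep their
    mass: only the bottom level gains, and the top level loses, one unit of
    flux.  The permutation [near] has the same net effect at once, by
    exchanging a single top element with a single bottom one.  The distances
    are therefore [l + 1] fluxes and one flux, whereas the total weight is
    [3l + 1] fluxes.  With [l] the integer part of [C] and a flux equal to
    [1/(4C - 1)], the distances fit the two thresholds, and the total weight is
    at most [(3C + 1)/(4C - 1) <= 1]; this is where [C >= 2] enters.  The gadget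
    has at most [2 * 4^l] elements, so that [m] is of order at least [n/4^C].

    When [n] is too small to hold one gadget, it suffices that a tester cannot
    do without samples, and a point mass shows this. *)

(** * Sampling and the method of two priors *)

(** Independence of the coordinates of a sample: a generalized distributivity
    law. *)
Lemma sum_tuple_prod (R : comNzRingType) (T : finType) (s : nat)
    (F : 'I_s -> T -> R) :
  \sum_(x : s.-tuple T) \prod_(j < s) F j (tnth x j) =
  \prod_(j < s) \sum_(t : T) F j t.
Proof.
rewrite bigA_distr_bigA /=.
rewrite (reindex (fun f : {ffun 'I_s -> T} => [tuple f i | i < s])) /=.
  by apply: eq_bigr => f _; apply: eq_bigr => j _; rewrite tnth_mktuple.
exists (fun x : s.-tuple T => [ffun i => tnth x i]) => [f _|x _].
  by apply/ffunP => i; rewrite ffunE tnth_mktuple.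
by apply: eq_from_tnth => i; rewrite tnth_mktuple ffunE.
Qed.

Section Output.
Variables (R : realType) (n s : nat) (A : algorithm R n s).

Definition output_prob (b : bool) (x : s.-tuple 'I_n) : R :=
  fine (seed_prob A (decide A x @^-1` [set b])%classic).

Lemma measurable_output b x : measurable (decide A x @^-1` [set b])%classic.
Proof.
rewrite -[X in measurable X]setTI.
exact: (measurable_decide x).
Qed.

Lemma output_prob_ge0 b x : 0 <= output_prob b x.
Proof. by apply: fine_ge0; exact: measure_ge0. Qed.

Lemma output_prob_total x : output_prob true x + output_prob false x = 1.
Proof.
have -> : output_prob false x = 1 - output_prob true x.
  rewrite /output_prob.
  have -> : (decide A x @^-1` [set false] = ~` (decide A x @^-1` [set true]))%classic.
    by apply/seteqP; split => w /=; case: (decide A x w).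
  rewrite probability_setC; last exact: measurable_output.
  rewrite fineB //.
  by apply: fin_num_measure; exact: measurable_output.
by rewrite addrC subrK.
Qed.

End Output.

Section TwoPriors.
Variables (R : realType) (n s : nat) (W : finType) (w0 : W).
Variables (P0 P1 : W -> dist R n) (bad : pred (s.-tuple 'I_n)).

Definition sample_prob (p : dist R n) (x : s.-tuple 'I_n) : R :=
  \prod_(j < s) p (tnth x j).

Lemma sample_prob_ge0 p x : 0 <= sample_prob p x.
Proof. by apply: prodr_ge0 => j _; exact: Defs.pmf_ge0. Qed.

Lemma sum_sample_prob p : \sum_x sample_prob p x = 1.
Proof.
rewrite (@sum_tuple_prod _ _ _ (fun _ => p : 'I_n -> R)).
by rewrite big1 // => j _; rewrite Defs.pmf_sum1.
Qed.

(** Le Cam's argument: averaged over the priors, the same sample law off [bad]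
    forces the success probabilities of the two answers to sum to at most
    [1 + eps], whereas success on both families requires [4/3]. *)
Lemma two_priors (A : algorithm R n s) (eps : R) :
  (forall x, ~~ bad x ->
     \sum_w sample_prob (P0 w) x = \sum_w sample_prob (P1 w) x) ->
  (forall w, \sum_(x | bad x) sample_prob (P1 w) x <= eps) ->
  (forall w, 2 / 3 <= prob_output A (P0 w) true) ->
  (forall w, 2 / 3 <= prob_output A (P1 w) false) ->
  1 / 3 <= eps.
Proof.
move=> same rare yes0 no1.
have W_gt0 : (0 < #|W|)%N by apply/card_gt0P; exists w0.
pose a := output_prob A.
have avg : \sum_w (prob_output A (P0 w) true + prob_output A (P1 w) false) <=
           \sum_(w : W) (1 + eps).
  pose S0 x := \sum_w sample_prob (P0 w) x.
  pose S1 x := \sum_w sample_prob (P1 w) x.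
  have S0_ge0 x : 0 <= S0 x by apply: sumr_ge0 => w _; exact: sample_prob_ge0.
  have S1_ge0 x : 0 <= S1 x by apply: sumr_ge0 => w _; exact: sample_prob_ge0.
  have -> : \sum_w (prob_output A (P0 w) true + prob_output A (P1 w) false) =
            \sum_(x : s.-tuple 'I_n) (S0 x * a true x + S1 x * a false x).
    rewrite !big_split /= /prob_output; congr (_ + _).
      by rewrite exchange_big /=; apply: eq_bigr => x _; rewrite -mulr_suml.
    by rewrite exchange_big /=; apply: eq_bigr => x _; rewrite -mulr_suml.
  (* Off [bad] the two answers share the common weight [S0 x]; on [bad] both are
     granted in full. *)
  apply: (@le_trans _ _ (\sum_(x : s.-tuple 'I_n) (S0 x + if bad x then S1 x else 0))).
    apply: ler_sum => x _.
    have a1 := output_prob_total A x; rewrite -/a in a1.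
    have a_ge0 := output_prob_ge0 A true x; rewrite -/a in a_ge0.
    have b_ge0 := output_prob_ge0 A false x; rewrite -/a in b_ge0.
    case: ifPn => [_|/same E].
      apply: lerD; apply: ler_piMr => //; lra.
    by rewrite -/(S0 x) -/(S1 x) in E; rewrite -E -mulrDr a1 mulr1 addr0.
  rewrite !big_split /=; apply: lerD.
    rewrite /S0 exchange_big; apply: ler_sum => w _.
    by rewrite sum_sample_prob.
  by rewrite -big_mkcond /S1 exchange_big; apply: ler_sum => w _; exact: rare.
have low : \sum_(w : W) (4 / 3 : R) <=
    \sum_w (prob_output A (P0 w) true + prob_output A (P1 w) false).
  by apply: ler_sum => w _; have := yes0 w; have := no1 w; lra.
have := le_trans low avg; rewrite !sumr_const lerMn2r.
rewrite eqn0Ngt W_gt0 /=; lra.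
Qed.

End TwoPriors.

(** * Collisions in a cell *)

Section Collisions.
Variables (T I : finType) (s : nat) (cell : T -> option I).

Definition collides (x : s.-tuple T) : bool :=
  [exists j, exists k, exists g,
    [&& j != k, cell (tnth x j) == Some g & cell (tnth x k) == Some g]].

(** A union bound over the pairs of samples and the cells; two given samples fall
    independently in a cell of mass at most [b]. *)
Lemma collision_bound (R : realType) (p : T -> R) (b : R) :
  (forall t, 0 <= p t) -> \sum_t p t = 1 ->
  (forall g, \sum_(t | cell t == Some g) p t <= b) ->
  \sum_(x | collides x) \prod_(j < s) p (tnth x j) <= s%:R ^+ 2 * (#|I|%:R * b ^+ 2).
Proof.
move=> p_ge0 p_sum1 cell_le.
pose hit j k g (x : s.-tuple T) :=
  (cell (tnth x j) == Some g) && (cell (tnth x k) == Some g).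
pose P (x : s.-tuple T) := \prod_(j < s) p (tnth x j).
have P_ge0 x : 0 <= P x by apply: prodr_ge0.
have pair_le j k g : j != k -> \sum_(x | hit j k g x) P x <= b ^+ 2.
  move=> jk.
  (* The event constrains the coordinates [j] and [k] separately, so its indicator
     goes into the factors of the product. *)
  pose F i t := if ((i == j) || (i == k)) && (cell t != Some g) then 0 else p t.
  have -> : \sum_(x | hit j k g x) P x =
      \sum_(x : s.-tuple T) \prod_i F i (tnth x i).
    rewrite big_mkcond; apply: eq_bigr => x _; rewrite /hit /P.
    case: ifPn => [/andP[/eqP xj /eqP xk]|].
      apply: eq_bigr => i _; rewrite /F.
      case: eqP => [->|_]; first by rewrite xj eqxx.
      by case: eqP => [->|_] //=; rewrite xk eqxx.
    rewrite negb_and => /orP[] h.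
      by rewrite (bigD1 j) //= {1}/F eqxx h /= mul0r.
    by rewrite (bigD1 k) //= {1}/F eqxx orbT h /= mul0r.
  have FE i : (i == j) || (i == k) ->
      \sum_t F i t = \sum_(t | cell t == Some g) p t.
    move=> ijk; rewrite [RHS]big_mkcond; apply: eq_bigr => t _.
    by rewrite /F ijk /=; case: eqP.
  rewrite sum_tuple_prod (bigD1 j) //= (bigD1 k) 1?eq_sym //= !FE ?eqxx ?orbT //.
  rewrite (big1 _ (fun i => (i != j) && (i != k))) ?mulr1.
    rewrite expr2.
    by apply: ler_pM => //; apply: sumr_ge0 => t _; exact: p_ge0.
  move=> i /andP[ij ik]; rewrite -[RHS]p_sum1; apply: eq_bigr => t _.
  by rewrite /F (negPf ij) (negPf ik).
have b2 : 0 <= b ^+ 2 by exact: sqr_ge0.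
pose Q x j k g := if (j != k) && hit j k g x then P x else 0.
have Q_ge0 x j k g : 0 <= Q x j k g by rewrite /Q; case: ifP.
have term_le (J : finType) (F : J -> R) i :
    (forall i', 0 <= F i') -> F i <= \sum_i' F i'.
  by move=> F_ge0; rewrite (bigD1 i) //= lerDl sumr_ge0.
have kg_ge0 x j k : 0 <= \sum_g Q x j k g by apply: sumr_ge0.
apply: (@le_trans _ _ (\sum_(x : s.-tuple T) \sum_j \sum_k \sum_g Q x j k g)).
  rewrite big_mkcond; apply: ler_sum => x _.
  case: ifP => [/existsP[j /existsP[k /existsP[g jkg]]]|_]; last first.
    by apply: sumr_ge0 => j _; apply: sumr_ge0.
  have le0 : P x <= Q x j k g by rewrite /Q /hit jkg.
  have le1 := term_le _ (Q x j k) g (Q_ge0 x j k).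
  have le2 := term_le _ (fun k => \sum_g Q x j k g) k (kg_ge0 x j).
  have le3 := term_le _ (fun j => \sum_k \sum_g Q x j k g) j
    (fun j => sumr_ge0 _ (fun k _ => kg_ge0 x j k)).
  exact: le_trans le0 (le_trans le1 (le_trans le2 le3)).
rewrite exchange_big /=.
have -> : s%:R ^+ 2 * (#|I|%:R * b ^+ 2) =
    \sum_(j < s) \sum_(k < s) \sum_(g : I) b ^+ 2.
  by rewrite !sumr_const !card_ord -!mulrnA -[RHS]mulr_natl !natrM; ring.
apply: ler_sum => j _; rewrite exchange_big; apply: ler_sum => k _.
rewrite exchange_big; apply: ler_sum => g _; rewrite -big_mkcond /=.
have [<-|jk] := eqVneq j k; first by rewrite big_pred0.
exact: pair_le.
Qed.

End Collisions.

(** * Independent randomization of the cells *)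

Section Resample.
Variables (R : comNzRingType) (T I W : finType) (s : nat).
Variables (cell : T -> option I) (h : T -> R).

Definition resample (f : W -> T -> R) (w : {ffun I -> W}) (t : T) : R :=
  if cell t is Some g then f (w g) t else h t.

(** Averaging over independent choices factors over the cells.  Without a
    collision, the factor of a cell involves at most one sample, so it depends
    only on the average of [f] at a single point. *)
Lemma resample_same_law (f0 f1 : W -> T -> R) (x : s.-tuple T) :
  (forall t, \sum_w f0 w t = \sum_w f1 w t) -> ~~ collides cell x ->
  \sum_w \prod_(j < s) resample f0 w (tnth x j) =
  \sum_w \prod_(j < s) resample f1 w (tnth x j).
Proof.
move=> same inj.
pose h' t := if cell t is Some _ then 1 else h t.
pose F (f : W -> T -> R) g w := \prod_(j < s)
  if cell (tnth x j) == Some g then f w (tnth x j) else 1 : R.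
have E f : \sum_w \prod_(j < s) resample f w (tnth x j) =
    \prod_(j < s) h' (tnth x j) * \prod_g \sum_w F f g w.
  rewrite bigA_distr_bigA big_distrr /=; apply: eq_bigr => w _.
  rewrite /F exchange_big -big_split /=; apply: eq_bigr => j _.
  rewrite /resample /h'; case: (cell (tnth x j)) => [g|]; last first.
    by rewrite big1 ?mulr1.
  rewrite mul1r (bigD1 g) //= eqxx big1 ?mulr1 // => g' g'g.
  by case: eqP => // -[gg']; rewrite gg' eqxx in g'g.
rewrite !E; congr (_ * _); apply: eq_bigr => g _; rewrite /F.
case: (pickP (fun j : 'I_s => cell (tnth x j) == Some g)) => [j xj|none].
  have one f w : (\prod_(j < s)
      if cell (tnth x j) == Some g then f w (tnth x j) else 1) = f w (tnth x j) :> R.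
    rewrite (bigD1 j) //= xj big1 ?mulr1 // => k kj.
    case: ifP => // xk; case/negP: inj.
    by apply/existsP; exists k; apply/existsP; exists j; apply/existsP; exists g; apply/and3P.
  by under eq_bigr do rewrite one; rewrite same; under [RHS]eq_bigr do rewrite one.
by apply: eq_bigr => w _; rewrite !big1 // => j _; rewrite none.
Qed.

End Resample.

(** * Shuffling the elements of equal weight *)

Section LevelAverage.
Variables (R : numDomainType) (V : eqType) (G : finType) (v : G -> V).

Definition level_preserving : {pred {perm G}} :=
  fun sigma => [forall x, v (sigma x) == v x].

Lemma level_preservingP (sigma : {perm G}) :
  reflect (forall x, v (sigma x) = v x) (sigma \in level_preserving).
Proof. exact: 'forall_eqP. Qed.

(** A double count: the level-preserving permutations contain the transposition
    of any two points of a level, so the sum does not change when [x] moves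
    inside its level, and they permute each level. *)
Lemma level_average (f : G -> R) x :
  (\sum_(sigma in level_preserving) f (sigma x)) *+ #|[pred y | v y == v x]| =
  (\sum_(y | v y == v x) f y) *+ #|level_preserving|.
Proof.
have mulP (a b : {perm G}) : a \in level_preserving ->
    ((a * b)%g \in level_preserving) = (b \in level_preserving).
  move=> /level_preservingP aP; apply/level_preservingP/level_preservingP => H y.
    by rewrite -[in LHS](permKV a y) -permM H -[in RHS](permKV a y) aP.
  by rewrite permM H aP.
have move_point y : v y == v x ->
    \sum_(sigma in level_preserving) f (sigma x) =
    \sum_(sigma in level_preserving) f (sigma y).
  move=> /eqP yx.
  have tP : tperm x y \in level_preserving.
    by apply/level_preservingP => z; case: tpermP => // ->.
  rewrite (reindex_inj (mulgI (tperm x y))) /=.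
  by apply: eq_big => [b|b _]; rewrite ?mulP // permM tpermL.
rewrite -sumr_const.
under eq_bigr => y yx do rewrite (move_point y yx).
rewrite exchange_big /= -sumr_const; apply: eq_bigr => sigma /level_preservingP sP.
by rewrite [RHS](reindex_inj (@perm_inj _ sigma)) /=; apply: eq_bigl => y; rewrite sP.
Qed.

Lemma eq_level_average (f0 f1 : G -> R) :
  (forall c, \sum_(y | v y == c) f0 y = \sum_(y | v y == c) f1 y) ->
  forall x, \sum_(sigma in level_preserving) f0 (sigma x) =
            \sum_(sigma in level_preserving) f1 (sigma x).
Proof.
move=> same x; apply: (@pmulrnI _ #|[pred y | v y == v x]|).
  by apply/card_gt0P; exists x; rewrite inE.
by rewrite /= !level_average same.
Qed.

End LevelAverage.

(** * Many copies of a gadget *)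

Section Copies.
Variables (R : realType) (G : finType) (w : G -> R) (m r n : nat).
Variables (dec : 'I_n -> ('I_m * G) + 'I_r) (enc : ('I_m * G) + 'I_r -> 'I_n).
Hypotheses (decK : cancel dec enc) (encK : cancel enc dec).
Hypotheses (w_ge0 : forall x, 0 <= w x) (w_le1 : \sum_x w x <= 1).
Hypotheses (m_gt0 : (0 < m)%N) (r_gt0 : (0 < r)%N).

(** The copy [g] is rearranged by [phi g]; the points outside the copies share the
    missing mass equally and are the same for every [phi], so they never help
    the tester. *)
Definition copies_pmf (phi : 'I_m -> {perm G}) (i : 'I_n) : R :=
  match dec i with
  | inl (g, x) => w (phi g x) / m%:R
  | inr _ => (1 - \sum_x w x) / r%:R
  end.

Definition copy_of (i : 'I_n) : option 'I_m :=
  if dec i is inl (g, _) then Some g else None.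

Lemma sum_domain (P : pred 'I_n) (F : 'I_n -> R) :
  \sum_(i | P i) F i =
  \sum_g \sum_(x | P (enc (inl (g, x)))) F (enc (inl (g, x))) +
  \sum_(j | P (enc (inr j))) F (enc (inr j)).
Proof.
rewrite (reindex enc) /=; last by apply: onW_bij; exists dec.
rewrite big_sumType /=; congr (_ + _).
by rewrite pair_big_dep /=; apply: eq_big => [[]|[]].
Qed.

Lemma copies_pmf_ge0 phi i : 0 <= copies_pmf phi i.
Proof.
rewrite /copies_pmf; case: (dec i) => [[g x]|_]; apply: divr_ge0 => //.
by rewrite subr_ge0.
Qed.

Lemma sum_one_copy phi g :
  \sum_x copies_pmf phi (enc (inl (g, x))) = (\sum_x w x) / m%:R.
Proof.
rewrite [in RHS](reindex_inj (@perm_inj _ (phi g))) /= mulr_suml.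
by apply: eq_bigr => x _; rewrite /copies_pmf encK.
Qed.

Lemma copies_pmf_sum1 phi : \sum_i copies_pmf phi i = 1.
Proof.
rewrite sum_domain; under eq_bigr do rewrite sum_one_copy.
under [X in _ + X]eq_bigr do rewrite /copies_pmf encK.
rewrite !sumr_const !card_ord -[X in X + _]mulr_natl -[X in _ + X]mulr_natl.
rewrite mulrCA mulfV ?pnatr_eq0 -?lt0n // mulrCA mulfV ?pnatr_eq0 -?lt0n //.
by rewrite !mulr1 addrC subrK.
Qed.

Definition copies_dist phi : dist R n :=
  Dist (copies_pmf_ge0 phi) (copies_pmf_sum1 phi).

Lemma copies_perm_class phi :
  perm_class (copies_dist (fun=> 1%g)) (copies_dist phi).
Proof.
pose move i := enc (match dec i with
  | inl (g, x) => inl (g, phi g x) | inr j => inr j end).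
have move_inj : injective move.
  move=> i k /(can_inj encK) ik; apply: (can_inj decK); move: ik.
  case: (dec i) => [[g x]|j]; case: (dec k) => [[g' x']|j'] //.
  by case=> <- /perm_inj ->.
exists (perm move_inj) => i /=; rewrite permE /copies_pmf /move encK.
by case: (dec i) => [[g x]|j] //; rewrite perm1.
Qed.

Lemma copies_dTV phi :
  dTV (copies_dist phi) (copies_dist (fun=> 1%g)) =
  (\sum_g \sum_x `|w (phi g x) - w x|) / 2 / m%:R.
Proof.
rewrite dTV_half_l1 sum_domain [X in _ + X]big1 ?addr0.
  rewrite mulrAC; congr (_ / 2); rewrite mulr_suml; apply: eq_bigr => g _.
  rewrite mulr_suml; apply: eq_bigr => x _.
  rewrite /= /copies_pmf encK perm1 -mulrBl normrM; congr (_ * _).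
  by apply/ger0_norm; rewrite invr_ge0.
by move=> j _; rewrite /= /copies_pmf encK subrr normr0.
Qed.

Lemma copy_mass_le phi g :
  \sum_(i | copy_of i == Some g) copies_dist phi i <= m%:R^-1.
Proof.
rewrite sum_domain [X in _ + X]big_pred0 ?addr0; last first.
  by move=> j; rewrite /copy_of encK.
rewrite (bigD1 g) //= [X in _ + X]big1 ?addr0; last first.
  move=> g' g'g; rewrite big_pred0 // => x; rewrite /copy_of encK.
  by apply/eqP => -[gg']; rewrite gg' eqxx in g'g.
under eq_bigl do rewrite /copy_of encK eqxx.
rewrite sum_one_copy -[leRHS]mul1r; exact: ler_wpM2r.
Qed.

(** The rearrangements [near] and [far] are compared after a random shuffle of each
    copy within the levels of [w]: the shuffle does not change the distance to
    the reference, and hides everything but the level of a sampled element. *)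
Section TwoFamilies.
Variables (near far : {perm G}).
Hypothesis balanced : forall c,
  \sum_(y | w y == c) w (near y) = \sum_(y | w y == c) w (far y).

Let shuffle := {sigma in level_preserving w}.

Definition shuffled (tau : {perm G}) (omega : {ffun 'I_m -> shuffle}) : dist R n :=
  copies_dist (fun g => val (omega g) * tau)%g.

(** The choice of [fun=> 1] for the points outside the cells is arbitrary, since
    their mass is the same for every arrangement. *)
Lemma shuffledE tau omega i :
  shuffled tau omega i =
  resample copy_of (copies_pmf (fun=> 1%g))
    (fun (sigma : shuffle) i => if dec i is inl (_, x)
       then w (tau (val sigma x)) / m%:R else 0) omega i.
Proof.
rewrite /shuffled /= /resample /copies_pmf /copy_of.
by case: (dec i) => [[g x]|j] //; rewrite permM.
Qed.

Lemma shuffled_same_law (s : nat) (x : s.-tuple 'I_n) :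
  ~~ collides copy_of x ->
  \sum_omega sample_prob (shuffled near omega) x =
  \sum_omega sample_prob (shuffled far omega) x.
Proof.
move=> inj; rewrite /sample_prob.
under eq_bigr do under eq_bigr do rewrite shuffledE.
under [RHS]eq_bigr do under eq_bigr do rewrite shuffledE.
apply: resample_same_law => // t; case: (dec t) => [[_ y]|_] //.
rewrite -!mulr_suml; congr (_ / _).
rewrite -(big_sub (level_preserving w) (fun sigma : {perm G} => w (near (sigma y)))).
rewrite -(big_sub (level_preserving w) (fun sigma : {perm G} => w (far (sigma y)))).
exact: (eq_level_average (f0 := fun y => w (near y)) (f1 := fun y => w (far y))).
Qed.

Lemma shuffled_dTV tau omega :
  dTV (shuffled tau omega) (copies_dist (fun=> 1%g)) =
  (\sum_x `|w (tau x) - w x|) / 2.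
Proof.
rewrite copies_dTV.
rewrite (eq_bigr (fun=> \sum_x `|w (tau x) - w x|)); last first.
  move=> g _; rewrite [RHS](reindex_inj (@perm_inj _ (val (omega g)))) /=.
  apply: eq_bigr => x _; rewrite permM.
  by have /level_preservingP -> := valP (omega g).
rewrite sumr_const card_ord -[_ *+ m]mulr_natl; field.
by rewrite pnatr_eq0 -lt0n.
Qed.

(** Two priors with the collisions as exceptional event: [m] copies of mass at most
    [1/m] give collision probability at most [s^2/m], which must be at least
    [1/3]. *)
Lemma copies_lower_bound (a b : R) (s : nat) (A : algorithm R n s) :
  (\sum_x `|w (near x) - w x|) / 2 <= a ->
  b <= (\sum_x `|w (far x) - w x|) / 2 ->
  distinguishes A (copies_dist (fun=> 1%g)) a b ->
  m%:R <= 3 * s%:R ^+ 2 :> R.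
Proof.
move=> near_le far_ge dist_A.
have id_level : 1%g \in level_preserving w.
  by apply/level_preservingP => x; rewrite perm1.
pose omega0 : {ffun 'I_m -> shuffle} := [ffun=> exist _ 1%g id_level].
have m0 : m%:R != 0 :> R by rewrite pnatr_eq0 -lt0n.
have /= := @two_priors R n s _ omega0 (shuffled near) (shuffled far)
  (collides copy_of) A (s%:R ^+ 2 / m%:R) _ _ _ _.
move=> H; suff : 1 / 3 <= s%:R ^+ 2 / m%:R :> R.
  rewrite ler_pdivlMr ?ltr0n // => ?; lra.
apply: H => [x|omega|omega|omega].
- exact: shuffled_same_law.
- have -> : s%:R ^+ 2 / m%:R = s%:R ^+ 2 * (#|'I_m|%:R * m%:R^-1 ^+ 2) :> R.
    by rewrite card_ord expr2 mulrA mulrA mulfK.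
  apply: collision_bound.
  + exact: Defs.pmf_ge0.
  + exact: Defs.pmf_sum1.
  + exact: copy_mass_le.
- have [+ _] := dist_A _ (copies_perm_class (fun g => val (omega g) * near)%g).
  by apply; rewrite shuffled_dTV.
- have [_ +] := dist_A _ (copies_perm_class (fun g => val (omega g) * far)%g).
  by apply; rewrite shuffled_dTV.
Qed.

End TwoFamilies.
End Copies.

(** The statement above for a concrete identification of the domain: the elements
    not used by the [m] copies serve as fixed points, and there is at least one
    of them. *)
Lemma gadget_lower_bound (R : realType) (G : finType) (w : G -> R)
    (near far : {perm G}) (a b : R) (m n : nat) :
  (forall x, 0 <= w x) -> \sum_x w x <= 1 ->
  (forall c, \sum_(y | w y == c) w (near y) = \sum_(y | w y == c) w (far y)) ->
  (\sum_x `|w (near x) - w x|) / 2 <= a ->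
  b <= (\sum_x `|w (far x) - w x|) / 2 ->
  (0 < m)%N -> (m * #|G| < n)%N ->
  exists q : dist R n, forall (s : nat) (A : algorithm R n s),
    distinguishes A q a b -> m%:R <= 3 * s%:R ^+ 2 :> R.
Proof.
move=> w_ge0 w_le1 bal near_le far_ge m_gt0 mG.
pose r := (n - m * #|G|)%N.
have r_gt0 : (0 < r)%N by rewrite subn_gt0.
have card_n : n = #|{: ('I_m * G) + 'I_r}|.
  by rewrite card_sum card_prod !card_ord subnKC // ltnW.
pose dec (i : 'I_n) : ('I_m * G) + 'I_r := enum_val (cast_ord card_n i).
pose enc (d : ('I_m * G) + 'I_r) : 'I_n := cast_ord (esym card_n) (enum_rank d).
have decK : cancel dec enc by move=> i; rewrite /dec /enc enum_valK cast_ordK.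
have encK : cancel enc dec by move=> d; rewrite /dec /enc cast_ordKV enum_rankK.
exists (copies_dist decK encK w_ge0 w_le1 m_gt0 r_gt0 (fun=> 1%g)) => s A.
exact: copies_lower_bound.
Qed.

(** * The gadget *)

Section Gadget.
Variables (R : realType) (u : R) (l : nat).
Hypothesis u_ge0 : 0 <= u.

Definition level (k : nat) : R := if k is k'.+1 then u * 2 ^+ k' else 0.

(** The number of pairs joining the levels [k] and [k.+1]: their gap is [2^(k.-1)]
    (in units of [u]), so that gap times number is [2^l] for every [k <= l]. *)
Definition mult (k : nat) : nat := 2 ^ (l - k.-1).

(** The element [(k, i, b)] is an end of the [i]-th pair between the levels [k] and
    [k.+1], the upper one when [b] holds.  Having [2^l] pairs for each [k] gives
    a plain product type; the pairs beyond [mult k] receive weight [0] at both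
    ends, and thus weigh nothing in any sum below. *)
Definition gadget : finType := ('I_l.+1 * 'I_(2 ^ l) * bool)%type.

Definition weight (y : gadget) : R :=
  let: (k, i, b) := y in if (i < mult k)%N then level (k + b) else 0.

Definition flip (y : gadget) : gadget := let: (k, i, b) := y in (k, i, ~~ b).

Lemma flip_inj : injective flip.
Proof. by move=> [[k i] b] [[k' i'] b'] [-> -> /negb_inj ->]. Qed.

Definition far : {perm gadget} := perm flip_inj.

Definition origin : 'I_(2 ^ l) := Ordinal (expn_gt0 2 l).

Definition bottom : gadget := (ord0, origin, false).
Definition top : gadget := (ord_max, origin, true).

Definition near : {perm gadget} := tperm bottom top.

(** The mass that [far] moves across each gap, and [near] from top to bottom. *)
Definition flux : R := u * 2 ^+ l.

Lemma weight_bottom : weight bottom = 0.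
Proof. by rewrite /= if_same. Qed.

Lemma weight_top : weight top = flux.
Proof. by rewrite /= expn_gt0 addn1. Qed.

Lemma level_ge0 k : 0 <= level k.
Proof. by case: k => [|k] //=; rewrite mulr_ge0 ?exprn_ge0. Qed.

Lemma weight_ge0 y : 0 <= weight y.
Proof. by case: y => [[k i] b] /=; case: ifP => // _; exact: level_ge0. Qed.

Lemma level_gap k : (k <= l)%N -> (level k.+1 - level k) *+ mult k = flux.
Proof.
case: k => [_|k kl]; rewrite /flux /mult /= ?expr0 ?mulr1 ?subr0.
  by rewrite subn0 -[LHS]mulr_natr natrX.
rewrite -[in RHS](subnKC (ltnW kl)) exprD -[LHS]mulr_natr natrX exprS; ring.
Qed.

Lemma level_le k : level k <= level k.+1.
Proof.
case: k => [|k] /=; first by rewrite expr0 mulr1.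
have := exprn_ge0 k (ler0n R 2) => e0.
by rewrite exprS; apply: ler_wpM2l => //; lra.
Qed.

Lemma sum_far (phi : R -> R -> R) : phi 0 0 = 0 ->
  \sum_y phi (weight y) (weight (far y)) =
  \sum_(k < l.+1)
    (phi (level k) (level k.+1) + phi (level k.+1) (level k)) *+ mult k.
Proof.
move=> phi0.
transitivity (\sum_(k < l.+1) \sum_(i < 2 ^ l) \sum_(b : bool)
    phi (weight (k, i, b)) (weight (far (k, i, b)))).
  by rewrite !pair_bigA /=; apply: eq_bigr => -[[k i] b].
apply: eq_bigr => k _.
rewrite (eq_bigr (fun i : 'I_(2 ^ l) => if (i < mult k)%N
    then phi (level k) (level k.+1) + phi (level k.+1) (level k) else 0)).
  have mult_le : (mult k <= 2 ^ l)%N by rewrite leq_exp2l // leq_subr.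
  by rewrite -big_mkcond (big_ord_narrow mult_le) sumr_const card_ord.
move=> i _; rewrite big_bool /= !permE /=.
by case: ifP => _; rewrite ?addn0 ?addn1 ?phi0 ?addr0 // addrC.
Qed.

Lemma sum_near (phi : R -> R -> R) : (forall t, phi t t = 0) ->
  \sum_y phi (weight y) (weight (near y)) = phi 0 flux + phi flux 0.
Proof.
move=> phi0; have top_bottom : top != bottom by apply/eqP => -[].
rewrite (bigD1 bottom) // (bigD1 top) //= big1 ?addr0.
  by rewrite /near tpermL tpermR -/(weight bottom) -/(weight top) weight_bottom weight_top.
by move=> y /andP[yb yt]; rewrite tpermD // eq_sym.
Qed.

(** Within each level, [near] and [far] change the mass by the same amount.  For
    [far] the change is the difference of the equal fluxes across the gaps below
    and above, which telescopes to the contribution of the two extreme levels. *)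
Lemma gadget_balanced c :
  \sum_(y | weight y == c) weight (near y) =
  \sum_(y | weight y == c) weight (far y).
Proof.
pose phi (x y : R) := if x == c then y - x else 0.
have E (tau : {perm gadget}) : \sum_(y | weight y == c) weight (tau y) =
    \sum_y phi (weight y) (weight (tau y)) + \sum_(y | weight y == c) weight y.
  rewrite -big_mkcond -big_split /=.
  by apply: eq_bigr => y _; rewrite subrK.
have phi_id t : phi t t = 0 by rewrite /phi subrr if_same.
rewrite !E sum_near // sum_far //.
congr (_ + _).
pose g k : R := if level k == c then flux else 0.
rewrite (eq_bigr (fun k : 'I_l.+1 => g k - g k.+1)); last first.
  move=> k _; rewrite mulrnDl /phi /g; congr (_ + _).
    by case: ifP => _; rewrite ?mul0rn // level_gap // -ltnS.
  by case: ifP => _; rewrite ?mul0rn ?oppr0 // -opprB mulNrn level_gap // -ltnS.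
rewrite -(big_mkord xpredT (fun k => g k - g k.+1)).
rewrite (eq_bigr (fun k => - (g k.+1 - g k))); last by move=> k _; rewrite opprB.
rewrite sumrN telescope_sumr // opprB /g /phi /= -/flux subr0 sub0r.
by congr (_ + _); case: ifP => _; rewrite ?oppr0.
Qed.

(** The pairs between the levels [0] and [1] weigh one flux, those between [k] and
    [k.+1] with [k > 0] weigh three, because [2^(k-1) + 2^k] is three times the
    gap. *)
Lemma sum_weight : \sum_y weight y = (3 * l + 1)%:R * flux.
Proof.
rewrite (sum_far (phi := fun x _ => x)) // big_ord_recl /=.
have -> : (0 + u * 2 ^+ 0) *+ mult 0 = flux.
  by rewrite -(@level_gap 0) //= subr0 add0r.
rewrite (eq_bigr (fun=> 3 * flux)); last first.
  move=> k _; rewrite -[in RHS](@level_gap k.+1) ?ltn_ord // [RHS]mulrnAr.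
  by congr (_ *+ _); rewrite /= exprS; ring.
by rewrite sumr_const card_ord -[_ *+ l]mulr_natr natrD natrM; ring.
Qed.

Lemma near_displacement : (\sum_y `|weight (near y) - weight y|) / 2 = flux.
Proof.
have flux_ge0 : 0 <= flux by rewrite mulr_ge0 ?exprn_ge0.
rewrite (sum_near (phi := fun x y => `|y - x|)); last first.
  by move=> t; rewrite subrr normr0.
by rewrite subr0 sub0r normrN ger0_norm //; lra.
Qed.

Lemma far_displacement :
  (\sum_y `|weight (far y) - weight y|) / 2 = l.+1%:R * flux.
Proof.
rewrite (sum_far (phi := fun x y => `|y - x|)); last by rewrite subrr normr0.
rewrite (eq_bigr (fun=> 2 * flux)) ?sumr_const ?card_ord.
  by rewrite -[_ *+ l.+1]mulr_natl; field.
move=> k _; rewrite [X in _ + X]distrC ger0_norm ?subr_ge0 ?level_le //.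
have kl : (k <= l)%N by rewrite -ltnS.
by rewrite mulrnDl level_gap // mulr_natl mulr2n.
Qed.

Lemma card_gadget : #|gadget| = (l.+1 * 2 ^ l * 2)%N.
Proof. by rewrite /gadget /= !card_prod !card_ord card_bool. Qed.

Lemma card_gadget_le : (#|gadget| <= 2 * 4 ^ l)%N.
Proof.
rewrite card_gadget mulnC leq_mul2l /= (_ : 4 = 2 * 2)%N // expnMn.
by rewrite leq_mul2r ltn_expl ?orbT.
Qed.

End Gadget.

(** * Testing without samples *)

Section PointMass.
Variables (R : realType) (n : nat).

Definition point_pmf (i0 i : 'I_n) : R := (i == i0)%:R.

Lemma point_pmf_ge0 i0 i : 0 <= point_pmf i0 i.
Proof. exact: ler0n. Qed.

Lemma point_pmf_sum1 i0 : \sum_i point_pmf i0 i = 1.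
Proof.
rewrite (bigD1 i0) //= /point_pmf eqxx big1 ?addr0 // => i.
by move=> /negPf ->.
Qed.

Definition point_mass i0 : dist R n := Dist (@point_pmf_ge0 i0) (@point_pmf_sum1 i0).

Lemma point_mass_perm_class i0 i1 :
  perm_class (point_mass i0) (point_mass i1).
Proof.
exists (tperm i0 i1) => i /=; rewrite /point_pmf.
by rewrite -(inj_eq (@perm_inj _ (tperm i0 i1)) i i1) tpermR.
Qed.

Lemma dTV_refl (p : dist R n) : dTV p p = 0.
Proof.
by rewrite dTV_half_l1 big1 ?mul0r // => i _; rewrite subrr normr0.
Qed.

Lemma dTV_point_mass i0 i1 : i0 != i1 -> 1 <= dTV (point_mass i1) (point_mass i0).
Proof.
move=> i01; rewrite dTV_half_l1 (bigD1 i0) //= (bigD1 i1) 1?eq_sym //=.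
rewrite /point_pmf !eqxx (negPf i01) eq_sym (negPf i01) sub0r subr0 normrN normr1.
set S := (\sum_(i | _) _); have : 0 <= S by apply: sumr_ge0.
lra.
Qed.

(** Without samples the law of the output is the same for all distributions, so the
    two-prior bound applies with no exceptional event. *)
Lemma no_sample_lower_bound (i0 i1 : 'I_n) (a b : R) (s : nat)
    (A : algorithm R n s) :
  i0 != i1 -> 0 <= a -> b <= 1 ->
  distinguishes A (point_mass i0) a b -> (0 < s)%N.
Proof.
move=> i01 a_ge0 b_le1; case: s A => // A dist_A.
suff : 1 / 3 <= 0 :> R by lra.
apply: (@two_priors R n 0 unit tt (fun=> point_mass i0) (fun=> point_mass i1)
  pred0 A) => [x _|_|_|_].
- by rewrite /sample_prob; apply: eq_bigr => ? _; rewrite !big_ord0.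
- by rewrite big_pred0.
- have [+ _] := dist_A _ (point_mass_perm_class i0 i0).
  by apply; rewrite dTV_refl.
- have [_ +] := dist_A _ (point_mass_perm_class i0 i1).
  by apply; apply: le_trans b_le1 (dTV_point_mass i01).
Qed.

End PointMass.

(** * The lower bound *)

Theorem theorem4p9 (R : realType) :
  exists c : R, 0 < c /\
    forall (n : nat) (C : R), (2 <= n)%N -> 2 <= C ->
      exists q : dist R n,
        forall (s : nat) (A : algorithm R n s),
          distinguishes A q (1 / (4 * C - 1)) (C / (4 * C - 1)) ->
          c * Num.sqrt (n%:R / 4 `^ C) <= s%:R.
Proof.
exists (1 / 4); split => [|n C n_ge2 C_ge2]; first by lra.
pose l := Num.truncn C.
have /andP[l_le C_lt] : l%:R <= C < l.+1%:R by apply: truncn_itv; lra.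
pose G := gadget l.
have D_gt0 : 0 < 4 * C - 1 by lra.
have pow_gt0 : 0 < 4 `^ C by apply: powR_gt0.
have card_le : #|G|%:R <= 2 * 4 `^ C.
  apply: (@le_trans _ _ (2 * 4 ^ l)%N%:R).
    by rewrite ler_nat; exact: card_gadget_le.
  rewrite natrM natrX ler_wpM2l // -powR_mulrn //.
  by apply: ler_powR => //; lra.
(* The constant [1/4] comes from [sqrt 16 = 4]: up to [4^C], the domain size will be
   at most [4m <= 12 s^2], or at most [2 <= 2 s^2] when no gadget fits. *)
have bound (s : nat) (K : R) : K <= 16 * s%:R ^+ 2 -> n%:R <= K * 4 `^ C ->
    1 / 4 * Num.sqrt (n%:R / 4 `^ C) <= s%:R.
  move=> Ks nK; have s_ge0 : 0 <= s%:R :> R by [].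
  suff : Num.sqrt (n%:R / 4 `^ C) <= Num.sqrt ((4 * s%:R) ^+ 2).
    by rewrite sqrtr_sqr ger0_norm ?mulr_ge0 //; lra.
  rewrite ler_sqrt ?sqr_ge0 // ler_pdivrMr //.
  apply: (le_trans nK); rewrite ler_pM2r // exprMn; lra.
(* Dividing [n.-1] rather than [n] keeps a point outside the copies. *)
pose m := (n.-1 %/ #|G|)%N.
have G_gt0 : (0 < #|G|)%N by rewrite card_gadget !muln_gt0 expn_gt0.
have n_le : n%:R <= (m%:R + 1) * (2 * 4 `^ C).
  apply: (@le_trans _ _ (m.+1 * #|G|)%N%:R).
    rewrite ler_nat; have := ltn_ceil n.-1 G_gt0.
    by rewrite prednK // (leq_trans _ n_ge2).
  by rewrite natrM -natr1 ler_wpM2l.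
have [m0|m_gt0] := posnP m.
  pose i0 : 'I_n := Ordinal (ltnW n_ge2); pose i1 : 'I_n := Ordinal n_ge2.
  exists (point_mass R i0) => s A.
  move/no_sample_lower_bound => /(_ i1 isT) s_gt0.
  have {}s_gt0 : 1 <= s%:R :> R.
    rewrite ler1n; apply: s_gt0; first by rewrite divr_ge0 //; lra.
    rewrite ler_pdivrMr //; lra.
  apply: (bound s 2); last by move: n_le; rewrite m0; lra.
  by have := ler_pM ler01 ler01 s_gt0 s_gt0; rewrite -expr2; lra.
pose u : R := (2 ^+ l * (4 * C - 1))^-1.
have p2_gt0 : 0 < 2 ^+ l :> R by rewrite exprn_gt0.
have fluxE : flux u l = 1 / (4 * C - 1).
  by rewrite /flux /u; field; rewrite !lt0r_neq0.
have u_ge0 : 0 <= u by rewrite invr_ge0 mulr_ge0 // ltW.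
have [|||||q Hq] := @gadget_lower_bound R G (@weight R u l) (near l) (far l)
  (1 / (4 * C - 1)) (C / (4 * C - 1)) m n (weight_ge0 u_ge0) _ _ _ _ m_gt0.
- rewrite sum_weight fluxE mulrA mulr1 ler_pdivrMr // natrD natrM; lra.
- exact: gadget_balanced.
- by rewrite near_displacement // fluxE.
- rewrite far_displacement // fluxE mulrA mulr1 ler_pM2r ?invr_gt0 //; exact: ltW.
- by rewrite (leq_ltn_trans (leq_divM _ _)) // ltn_predL (leq_trans _ n_ge2).
exists q => s A /Hq m_le.
have m_ge1 : 1 <= m%:R :> R by rewrite ler1n.
apply: (bound s (4 * m%:R)); first by have := sqr_ge0 (s%:R : R); lra.
apply: (le_trans n_le); rewrite mulrA ler_pM2r //; lra.
Qed.
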